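(* Let $\sigma>0$ and $\beta>0$, and let $c(m,n,\sigma^2)=\frac1n C_G(m,n,\sigma^2)$. Then $$\liminf_{\substack{m,n\to\infty\\ n/m=\beta}} c(m,n,\sigma^2)\;\ge\;1-\inf_{\gamma>0}\;\sup_{t\in[0,1]}\left[H(t)+\frac1{2\beta}\left(\gamma\log_2 e-\log_2\left(1+\frac{\gamma}{\sigma^2}\big(\sigma^2+4t\beta\big)\right)\right)\right],$$ where $H(t)=-t\log_2 t-(1-t)\log_2(1-t)$ (with $H(0)=H(1)=0$).
   Context: Let $\mathcal M_{m\times n}(\pm1)$ be the set of $m\times n$ matrices with entries in $\{+1,-1\}$. For $A\in\mathcal M_{m\times n}(\pm1)$ the channel has input $X=(X_1,\dots,X_n)^T\in\{\pm1\}^n$ and output $Y=\frac1{\sqrt m}AX+N$, where $N=(N_1,\dots,N_m)^T$ has i.i.d. $\mathcal N(0,\sigma^2)$ entries and is independent of $X$. Its sum capacity $C(A)$ is $\max I(X;Y)$, where $I$ is mutual information in bits (base-2 logarithms) and the maximum is over all product distributions of $X$ on $\{\pm1\}^n$ (i.e. $X_1,\dots,X_n$ independent). $C_G(m,n,\sigma^2)=\max_{A\in\mathcal M_{m\times n}(\pm1)}C(A)$. The limit is over positive integers $m,n\to\infty$ with $n/m=\beta$ held fixed. *)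

(* Defs.v *)
From HB Require Import structures.
From mathcomp Require Import all_boot all_order all_algebra.
From mathcomp Require Import all_classical all_reals all_analysis.
From mathcomp Require Import measurable_realfun.

Set Implicit Arguments.
Unset Strict Implicit.
Unset Printing Implicit Defensive.

Import Order.TTheory GRing.Theory Num.Theory.
Import numFieldNormedType.Exports.

Local Open Scope classical_set_scope.
Local Open Scope ring_scope.

Definition log2 {R : realType} (x : R) : R := ln x / ln 2.

(* The usual convention 0 log 0 = 0 is automatic: 0 * log2 0 = 0. *)
Definition binary_entropy {R : realType} (t : R) : R :=
  - t * log2 t - (1 - t) * log2 (1 - t).

Section mutual_information.
Context {R : realType}.

(* Relative entropy D(mu || nu) in bits. Where mu `<< nu, the Radon-Nikodym
   derivative is finite everywhere and positive mu-almost everywhere, so that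
   neither fine nor the value of ln at nonpositive arguments matters. *)
Definition kl_divergence d (T : measurableType d) (mu nu : probability T R) :
    \bar R :=
  if `[< mu `<< nu >] then
    (\int[mu]_x (log2 (fine
       (Radon_Nikodym (charge_of_finite_measure mu) nu x)))%:E)%E
  else +oo%E.

Context d d1 d2 (Omega : measurableType d)
  (S : measurableType d1) (T : measurableType d2).

Definition rv_pair (X : {mfun Omega >-> S}) (Y : {mfun Omega >-> T})
  (w : Omega) : S * T := (X w, Y w).

Section instance.
Variables (X : {mfun Omega >-> S}) (Y : {mfun Omega >-> T}).

Let measurable_rv_pair : measurable_fun setT (rv_pair X Y).
Proof. exact: measurable_fun_pair. Qed.

HB.instance Definition _ :=
  isMeasurableFun.Build _ _ _ _ (rv_pair X Y) measurable_rv_pair.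
End instance.

Definition mutual_information (P : probability Omega R)
    (X : {mfun Omega >-> S}) (Y : {mfun Omega >-> T}) : \bar R :=
  kl_divergence (distribution P (rv_pair X Y))
    (distribution P X \x distribution P Y)%E.

End mutual_information.

Section tuple_prob.
Context {R : realType} d (T : measurableType d).

Definition tcons n (p : T * n.-tuple T) : n.+1.-tuple T :=
  [tuple of p.1 :: p.2].

Section instance.
Variable n : nat.

Let measurable_tcons : measurable_fun setT (@tcons n).
Proof. exact: measurable_cons. Qed.

HB.instance Definition _ :=
  isMeasurableFun.Build _ _ _ _ (@tcons n) measurable_tcons.
End instance.

(* The product measure mu 0 (x) ... (x) mu (n - 1), i.e. the joint law of
   independent random variables with respective laws mu i. *)
Fixpoint tuple_prob n : ('I_n -> probability T R) ->
    probability (n.-tuple T) R :=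
  match n with
  | 0 => fun=> \d_([tuple])
  | n'.+1 => fun mu =>
      distribution (mu ord0 \x tuple_prob (fun i => mu (lift ord0 i)))%E
        (@tcons n')
  end.

Lemma tuple_prob_rect n (mu : 'I_n -> probability T R) (A : 'I_n -> set T) :
  (forall i, measurable (A i)) ->
  tuple_prob mu [set t | forall i, A i (tnth t i)] = (\prod_i mu i (A i))%E.
Proof.
elim: n mu A => [|n IH] mu A mA.
  by rewrite big_ord0 /= diracE mem_set//= => -[].
rewrite big_ord_recl /= /distribution /pushforward.
rewrite (_ : _ @^-1` _ =
  A ord0 `*` [set t | forall i, A (lift ord0 i) (tnth t i)]); last first.
  apply/seteqP; split=> -[x t] /=.
    move=> At; split; first by have := At ord0; rewrite /tcons/=.
    by move=> i; have := At (lift ord0 i); rewrite /tcons/= tnthS.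
  move=> [Ax At] i; case: (unliftP ord0 i) => [j ->|-> //].
  by rewrite /tcons tnthS.
rewrite product_measure1E//.
  by congr (_ * _)%E; exact: (IH _ (fun i => A (lift ord0 i))).
rewrite (_ : [set t | _] = \bigcap_i
    ((fun t : n.-tuple T => tnth t i) @^-1` A (lift ord0 i))); last first.
  by apply/seteqP; split => [t At i _|t At i]; [exact: At|exact: (At i)].
apply: fin_bigcap_measurable => // i _.
rewrite -[X in measurable X]setTI.
exact: (measurable_tnth i).
Qed.

End tuple_prob.

Section channel.
Context {R : realType}.

(* R with its Borel sigma-algebra, as used by normal_prob. *)
Local Notation RR := (measurableTypeR R).

(* An input in {1, -1}^n is stored as a bit string, the bit b standing for
   (-1)^b. *)
Definition signs n (x : n.-tuple bool) : 'cV[R]_n :=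
  \col_j (-1) ^+ tnth x j.

Definition sign_matrix m n : set 'M[R]_(m, n) :=
  [set A | forall i j, A i j = 1 \/ A i j = -1].

(* The sample space carries the pair (input, noise) = (X, N). *)
Definition channel_input m n (w : n.-tuple bool * m.-tuple RR) :
    n.-tuple bool :=
  w.1.

Definition channel_output m n (A : 'M[R]_(m, n))
    (w : n.-tuple bool * m.-tuple RR) : m.-tuple RR :=
  [tuple ((Num.sqrt m%:R)^-1 *: (A *m signs w.1)) i 0 + tnth w.2 i | i < m].

Section instances.
Variables (m n : nat) (A : 'M[R]_(m, n)).

Let measurable_channel_input : measurable_fun setT (@channel_input m n).
Proof. exact: measurable_fst. Qed.

HB.instance Definition _ := isMeasurableFun.Build _ _ _ _
  (@channel_input m n) measurable_channel_input.

Let measurable_channel_output : measurable_fun setT (channel_output A).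
Proof.
apply/measurable_fun_tnthP => i.
rewrite (_ : _ \o _ = fun w : n.-tuple bool * m.-tuple RR =>
  (Num.sqrt m%:R)^-1 * (\sum_j A i j * (-1) ^+ tnth w.1 j) + tnth w.2 i).
  apply: measurable_funD.
    apply: measurable_funM => //; apply: measurable_sum => j.
    apply: measurable_funM => //.
    apply: (@measurableT_comp _ _ _ _ _ _ (fun b : bool => (-1) ^+ b : R)) => //.
    apply: (@measurableT_comp _ _ _ _ _ _ (fun t : n.-tuple bool => tnth t j)).
      exact: measurable_tnth.
    exact: measurable_fst.
  apply: (@measurableT_comp _ _ _ _ _ _ (fun t : m.-tuple RR => tnth t i)).
    exact: measurable_tnth.
  exact: measurable_snd.
apply/funext => w; rewrite /channel_output /= tnth_mktuple !mxE; congr (_ * _ + _).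
by apply: eq_bigr => j _; rewrite mxE.
Qed.

HB.instance Definition _ := isMeasurableFun.Build _ _ _ _
  (channel_output A) measurable_channel_output.
End instances.

(* Law of (X, N): X_1, ..., X_n independent with marginals mu j, and N
   independent of X with i.i.d. N(0, sigma^2) entries. Beware that the second
   argument of normal_prob is the standard deviation. *)
Definition channel_law m n (sigma : R) (mu : 'I_n -> probability bool R) :
    probability (n.-tuple bool * m.-tuple RR)%type R :=
  (tuple_prob mu \x
   tuple_prob (fun _ : 'I_m => normal_prob 0 sigma))%E.

(* mu ranges over all families of marginals, hence tuple_prob mu over all
   product distributions on {1, -1}^n. *)
Definition sum_capacity m n (sigma : R) (A : 'M[R]_(m, n)) : \bar R :=
  ereal_sup [set mutual_information (channel_law m sigma mu)
                   (@channel_input m n) (channel_output A)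
            | mu in [set: 'I_n -> probability bool R]].

Definition max_sum_capacity m n (sigma : R) : \bar R :=
  ereal_sup [set sum_capacity sigma A | A in @sign_matrix m n].

Definition normalized_capacity m n (sigma : R) : \bar R :=
  (n%:R^-1%:E * max_sum_capacity m n sigma)%E.

(* (m, n) -> (oo, oo) along pairs with n / m = beta. The filter is improper
   when no such pairs exist (beta irrational); limf_einf is then +oo. *)
Definition fixed_ratio_oo (beta : R) : set_system (nat * nat)%type :=
  within [set mn : nat * nat | mn.2%:R / mn.1%:R = beta]
    (filter_prod \oo \oo).

End channel.

(* Main.v *)
Require Import Defs.
From mathcomp Require Import all_boot all_order all_algebra.
From mathcomp Require Import all_classical all_reals all_analysis.
From mathcomp Require Import ring lra measurable_realfun.

Import Order.TTheory GRing.Theory Num.Theory.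
Import numFieldNormedType.Exports.

Local Open Scope classical_set_scope.
Local Open Scope ring_scope.

(* Take X uniform on {1, -1}^n. The Donsker-Varadhan inequality
   D(mu || nu) >= E_mu g - ln E_nu e^g, used with
   g (x, y) = - gamma |y - A x / sqrt m|^2 / (2 sigma^2), bounds I(X; Y) (in nats)
   from below by - gamma m / 2 - ln F(A), where F(A) is the average over
   independent uniform inputs x, x' of
     prod_i (1 + gamma)^(-1/2) exp (- gamma a_i^2 / (2 sigma^2 (1 + gamma))),
   with a = A (x' - x) / sqrt m. Some sign matrix A does at least as well as the
   average of F over all sign matrices, and for that average the rows decouple:
   each contributes E exp (- l S_d^2), with S_d a sum of d independent signs, d the
   Hamming distance of x and x', and l = O(1 / m). This is at most
   (1 + 2 l d)^(-(1 - 2 l) / 2), the Gaussian value up to a factor whose m-th power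
   stays bounded. Finally the number of x' at distance d from x is at most
   exp (n H(d / n)), H in nats, so that the bound holds for every m and n with
   an error O(log n / n). *)

(** * Exponential moments of squared sums of signs *)

Lemma fact_double_ge (k : nat) : (2 ^ k * k`! <= (2 * k)`!)%N.
Proof.
elim: k => // k IH; rewrite mulnS !addSn add0n 2!factS expnS factS.
rewrite (_ : 2 * 2 ^ k * (k.+1 * k`!) = (2 * k.+1) * (2 ^ k * k`!))%N; last first.
  by rewrite mulnACA.
apply: leq_mul; first by rewrite mulnS.
by apply: (leq_trans IH); rewrite leq_pmull.
Qed.

(* Termwise comparison of power series: (2k)! >= 2^k k!. *)
Lemma cosh_le_expR {R : realType} (y : R) :
  (expR y + expR (- y)) / 2 <= expR (y ^+ 2 / 2).
Proof.
rewrite ler_pdivrMr//.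
(* Among the first 2n terms the odd ones cancel, and each even pair is dominated by a single term of
   the other series. *)
have partial n : series (exp_coeff y) (2 * n)%N + series (exp_coeff (- y)) (2 * n)%N
    <= series (exp_coeff (y ^+ 2 / 2)) n * 2.
  elim: n => [|n IH]; first by rewrite muln0 /series/= !big_geq// mul0r addr0.
  rewrite mulnS !addSn add0n.
  have serS u k : series (u : R^nat) k.+1 = series u k + u k.
    by rewrite /series/= big_nat_recr.
  rewrite !serS mulrDl.
  have odd0 : exp_coeff y (2 * n).+1 + exp_coeff (- y) (2 * n).+1 = 0.
    by rewrite /exp_coeff/= exprNn -signr_odd /= oddM /= expr1 mulN1r mulNr subrr.
  have even : exp_coeff y (2 * n) + exp_coeff (- y) (2 * n) <=
      exp_coeff (y ^+ 2 / 2) n * 2.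
    rewrite /exp_coeff/= exprNn -signr_odd oddM /= expr0 mul1r -[X in X + X]mulr1 -mulrDr.
    rewrite ler_pM2r// exprM expr_div_n -mulrA ler_wpM2l//; first by apply: exprn_ge0; exact: sqr_ge0.
    rewrite -invfM lef_pV2 ?posrE ?mulr_gt0 ?exprn_gt0 ?ltr0n ?fact_gt0//.
    by rewrite -natrX -natrM ler_nat fact_double_ge.
  by lra.
have cv z : series (exp_coeff z) (2 * n)%N @[n --> \oo] --> expR (z : R).
  rewrite (_ : (fun n => _) = series (exp_coeff z) \o (muln 2))//.
  apply: cvg_comp; last exact: is_cvg_series_exp_coeff.
  apply/cvgnyPge => A; near=> n; rewrite (leq_trans (n := n))//.
    by near: n; exact: nbhs_infty_ge.
  by rewrite leq_pmull.
have cv2 : series (exp_coeff (y ^+ 2 / 2)) n * 2 @[n --> \oo] -->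
    expR (y ^+ 2 / 2) * 2.
  by apply: cvgMr_tmp; exact: is_cvg_series_exp_coeff.
apply: (ler_cvg_to (cvgD (cv y) (cv (- y))) cv2).
by near=> n; exact: partial.
Unshelve. all: end_near. Qed.

(** Expanding the squares leaves exp (- l (y^2 + 1)) cosh (2 l y). The bound on cosh turns the cross
    term into exp (2 l^2 y^2), which lowers the coefficient of y^2 from l to l (1 - 2 l). *)
Lemma expR_sqr_avg {R : realType} (l y : R) :
  (expR (- l * (y + 1) ^+ 2) + expR (- l * (y - 1) ^+ 2)) / 2 <=
  expR (- l) * expR (- (l * (1 - 2 * l)) * y ^+ 2).
Proof.
rewrite (_ : - l * (y + 1) ^+ 2 = - l * (y ^+ 2 + 1) + (- (2 * l * y))); last by ring.
rewrite (_ : - l * (y - 1) ^+ 2 = - l * (y ^+ 2 + 1) + 2 * l * y); last by ring.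
rewrite (expRD _ (- (2 * l * y))) (expRD _ (2 * l * y)) -mulrDr -mulrA.
apply: (le_trans (ler_wpM2l (expR_ge0 _) (_ : _ <= expR ((2 * l * y) ^+ 2 / 2)))).
  by rewrite addrC cosh_le_expR.
by rewrite -!expRD ler_expR le_eqVlt; apply/orP; left; apply/eqP; field.
Qed.

Lemma sum_tuple_cons {V : nmodType} (n : nat) (F : n.+1.-tuple bool -> V) :
  \sum_r F r = \sum_(t : n.-tuple bool) (F [tuple of false :: t] + F [tuple of true :: t]).
Proof.
rewrite (reindex (fun bt : bool * n.-tuple bool => [tuple of bt.1 :: bt.2])) /=; last first.
  exists (fun t => (thead t, [tuple of behead t])) => [[b t] _|t _].
    by congr pair; apply: val_inj.
  by rewrite [RHS]tuple_eta.
rewrite -(pair_bigA _ (fun (b : bool) (t : n.-tuple bool) => F [tuple of b :: t])) /= big_bool.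
by rewrite -big_split; apply: eq_bigr => t _ /=; rewrite addrC.
Qed.

(** This is the cost of replacing l by l (1 - 2 l) while d drops by one: the two arguments of [ln]
    have ratio at most 1 / (1 - 2 l) = 1 + 2 l / (1 - 2 l), and ln (1 + u) <= u. *)
Lemma ln_le_step {R : realType} (l : R) (d : nat) : 0 <= l -> 2 * l < 1 ->
  ln (1 + 2 * l * d.+1%:R) <=
  ln (1 + 2 * (l * (1 - 2 * l)) * d%:R) + 2 * l / (1 - 2 * l).
Proof.
move=> l0 l1.
have q0 : 0 < 1 - 2 * l by lra.
have d0 : 0 <= d%:R :> R by [].
have p0 : 0 < 1 + 2 * (l * (1 - 2 * l)) * d%:R.
  by rewrite ltr_pwDl// !mulr_ge0// ltW.
have le1 : 1 + 2 * l * d.+1%:R <= (1 + 2 * (l * (1 - 2 * l)) * d%:R) * (1 - 2 * l)^-1.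
  rewrite ler_pdivlMr// -natr1.
  have : 0 <= 4 * l ^+ 2 by rewrite mulr_ge0// sqr_ge0.
  have : 0 <= l * d%:R by rewrite mulr_ge0.
  have : 0 <= l ^+ 2 * d%:R by rewrite mulr_ge0// sqr_ge0.
  by move=> ? ? ?; nra.
have p1 : 0 < 1 + 2 * l * d.+1%:R by rewrite ltr_pwDl// !mulr_ge0.
apply: (@le_trans _ _ (ln ((1 + 2 * (l * (1 - 2 * l)) * d%:R) / (1 - 2 * l)))).
  by rewrite ler_ln ?posrE ?mulr_gt0 ?invr_gt0.
rewrite lnM ?posrE ?invr_gt0// lerD2l.
rewrite [X in ln X](_ : (1 - 2 * l)^-1 = 1 + 2 * l / (1 - 2 * l)); last by field; rewrite gt_eqF.
apply: le_ln1Dx; apply: (@lt_le_trans _ _ 0) => //.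
by rewrite divr_ge0 ?mulr_ge0// ltW.
Qed.

(* For independent signs, E exp(-l (S_d + s)^2) over the last sign s is at most
   exp(-l) E exp(-l (1 - 2 l) S_d^2); the exponent (1 - 2 l) / 2 absorbs the
   drift of l along the induction on the number of signs. *)
Lemma rademacher_expR_sqr_le {R : realType} (n : nat) (l : R) (v : 'I_n -> R) :
  0 <= l -> 2 * l < 1 -> (forall j, v j = 0 \/ v j = 1 \/ v j = -1) ->
  2^-1 ^+ n * \sum_(r : n.-tuple bool)
    expR (- l * (\sum_j (-1) ^+ tnth r j * v j) ^+ 2) <=
  expR (- ((1 - 2 * l) / 2) * ln (1 + 2 * l * (\sum_j (v j != 0)%:R))).
Proof.
elim: n l v => [|n IH] l v l0 l1 hv.
  rewrite (big_pred1 [tuple]) => [|t]; last by rewrite /= tuple0; apply/esym/eqP.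
  by rewrite !big_ord0 expr0 mul1r mulr0 addr0 ln1 mulr0 expr0n /= mulr0.
rewrite sum_tuple_cons.
under eq_bigr => t _ do rewrite !big_ord_recl !tnth0 /= expr0 expr1 mul1r mulN1r.
under eq_bigr => t _.
  under eq_bigr => j _ do rewrite tnthS.
  under [X in _ + expR (_ * (_ + X) ^+ 2)]eq_bigr => j _ do rewrite tnthS.
  over.
rewrite big_ord_recl.
(* A sign with zero coefficient changes nothing: both halves of the average coincide and l is
   kept. *)
have [v0|v0] := eqVneq (v ord0) 0.
  under eq_bigr => t _ do rewrite v0 oppr0 !add0r -mulr2n -mulr_natl.
  rewrite -mulr_sumr mulrA exprSr mulfVK// add0r.
  exact: IH.
set l' := l * (1 - 2 * l).
have l'l : l' <= l by rewrite /l' ler_piMr//; lra.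
have l'0 : 0 <= l' by rewrite /l' mulr_ge0//; lra.
apply: (@le_trans _ _ (2^-1 ^+ n * \sum_(t : n.-tuple bool) expR (- l) *
   expR (- l' * (\sum_j (-1) ^+ tnth t j * v (lift ord0 j)) ^+ 2))).
  rewrite exprSr -mulrA ler_wpM2l ?exprn_ge0// mulr_sumr ler_sum// => t _.
  set y := \sum_j _.
  rewrite mulrC; apply: le_trans (expR_sqr_avg l y).
  have [v00|[->|->]] := hv ord0; first by rewrite v00 eqxx in v0.
    by rewrite !(addrC _ y).
  by rewrite opprK !(addrC _ y) [X in X / 2]addrC.
rewrite -mulr_sumr mulrCA.
have l'1 : 2 * l' < 1 by lra.
have IH' := IH l' (fun j => v (lift ord0 j)) l'0 l'1 (fun j => hv _).
apply: (le_trans (ler_wpM2l (expR_ge0 _) IH')).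
rewrite -expRD ler_expR -natr_sum /=.
set d := (\sum_j _)%N.
rewrite -natrD add1n.
have := ln_le_step l d l0 l1; rewrite -/l'.
set A := ln (1 + 2 * l * _); set B := ln (1 + 2 * l' * _) => AB.
have B0 : 0 <= B by rewrite ln_ge0// lerDl mulr_ge0// mulr_ge0.
have h : (1 - 2 * l) * (2 * l / (1 - 2 * l)) = 2 * l.
  by rewrite mulrC mulfVK// gt_eqF//; lra.
(* The factor exp (- l) gained from the first sign pays for the additive 2 l; then B >= 0 and l' <=
   l allow the weight 1 - 2 l to grow to 1 - 2 l'. *)
have : (1 - 2 * l) * A <= (1 - 2 * l) * B + 2 * l.
  apply: (@le_trans _ _ ((1 - 2 * l) * (B + 2 * l / (1 - 2 * l)))).
    by rewrite ler_wpM2l//; lra.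
  by rewrite mulrDr h.
have : (1 - 2 * l) * B <= (1 - 2 * l') * B by rewrite ler_wpM2r//; lra.
by nra.
Qed.

(** * Gaussian integrals *)

(** The Radon-Nikodym derivative and the Gaussian density have the same integral over every
    measurable set, hence agree almost everywhere. *)
Lemma ge0_integral_normal_prob {R : realType} (m s : R)
    (f : measurableTypeR R -> \bar R) :
  measurable_fun setT f -> (forall x, 0 <= f x)%E ->
  (\int[normal_prob m s]_x f x =
   \int[lebesgue_measure]_x (f x * (normal_pdf m s x)%:E))%E.
Proof.
move=> mf f0; have dom := normal_prob_dominates m s.
rewrite -(Radon_Nikodym_SigmaFinite.change_of_variables dom)//.
have mp : measurable_fun setT (fun x => (normal_pdf m s x)%:E).
  by apply/measurable_EFinP; exact: measurable_normal_pdf.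
have mr := measurable_int _ (Radon_Nikodym_SigmaFinite.f_integrable dom).
apply: ae_eq_integral => //; [exact: emeasurable_funM..|].
apply: ae_eqe_mul2l; apply: integral_ae_eq => //.
  exact: Radon_Nikodym_SigmaFinite.f_integrable.
by move=> A _ mA; rewrite -Radon_Nikodym_SigmaFinite.f_integral.
Qed.

(* Completing the square turns the integrand times the density into a multiple
   of the density of another normal distribution. *)
Lemma integral_normal_expR {R : realType} (s g a : R) : 0 < s -> 0 < 1 + g ->
  (\int[normal_prob 0 s]_x (expR (- g * (a + x) ^+ 2 / (2 * s ^+ 2)))%:E =
   ((Num.sqrt (1 + g))^-1 *
    expR (- (g / (1 + g)) * a ^+ 2 / (2 * s ^+ 2)))%:E)%E.
Proof.
move=> s0 g0; have s'0 : s != 0 by rewrite gt_eqF.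
rewrite ge0_integral_normal_prob; first last.
- by move=> x; rewrite lee_fin expR_ge0.
- apply/measurable_EFinP; apply: measurableT_comp => //.
  apply: measurable_funM => //; apply: measurable_funM => //.
  by apply: measurable_funX; exact: measurable_funD.
set q := Num.sqrt (1 + g).
have q0 : 0 < q by rewrite sqrtr_gt0.
have q2 : q ^+ 2 = 1 + g by rewrite sqr_sqrtr// ltW.
have sq0 : s / q != 0 by rewrite mulf_neq0// invr_eq0 gt_eqF.
set b := - (g * a / (1 + g)).
transitivity (\int[lebesgue_measure]_x
   ((q^-1 * expR (- (g / (1 + g)) * a ^+ 2 / (2 * s ^+ 2)))%:E *
    (normal_pdf b (s / q) x)%:E))%E.
  apply: eq_integral => x _; rewrite -!EFinM; congr (_%:E).
  rewrite !normal_pdfE// /normal_fun.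
  have -> : normal_peak (s / q) = q * normal_peak s.
    rewrite /normal_peak.
    rewrite (_ : (s / q) ^+ 2 * pi *+ 2 = (1 + g)^-1 * (s ^+ 2 * pi *+ 2)); last first.
      by rewrite expr_div_n q2; field; rewrite gt_eqF.
    by rewrite sqrtrM ?invr_ge0 ?ltW// sqrtrV ?ltW// invfM invrK.
  rewrite mulrCA -expRD [RHS](_ : _ = normal_peak s * (expR (- (g / (1 + g)) * a ^+ 2 / (2 * s ^+ 2)) *
    expR (- (x - b) ^+ 2 / ((s / q) ^+ 2 *+ 2)))); last by field; rewrite gt_eqF.
  rewrite -expRD; congr (_ * expR _).
  by rewrite expr_div_n q2 /b; field; rewrite s'0 !gt_eqF.
rewrite integralZl//; last exact: integrable_normal_pdf.
by rewrite integral_normal_pdf mule1.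
Qed.

(* By 1 + u <= exp u, the exponential moments
   E exp (e N^2 / (2 s^2)) = 1 / sqrt (1 - e) bound the second moment as e tends
   to 0. Below, e = 1 - q^2. *)
Lemma integral_normal_sqr_le {R : realType} (s : R) : 0 < s ->
  (\int[normal_prob 0 s]_x (x ^+ 2 / (2 * s ^+ 2))%:E <= 2^-1%:E)%E.
Proof.
move=> s0; set E := (\int[_]_x _)%E.
have mf : measurable_fun setT (fun x : measurableTypeR R => (x ^+ 2 / (2 * s ^+ 2))%:E).
  by apply/measurable_EFinP; apply: measurable_funM => //; exact: measurable_funX.
have f0 (x : measurableTypeR R) : (0 <= (x ^+ 2 / (2 * s ^+ 2))%:E)%E.
  by rewrite lee_fin divr_ge0 ?sqr_ge0// mulr_ge0// sqr_ge0.
(* The Gaussian integral with the negative parameter g = q^2 - 1 and a = 0 equals 1 / q. *)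
have key q : 0 < q < 1 -> ((1 - q ^+ 2)%:E * E <= (q^-1 - 1)%:E)%E.
  move=> /andP[q0 q1].
  have q21 : q ^+ 2 < 1 by rewrite expr_lt1// ltW.
  have := @integral_normal_expR R s (q ^+ 2 - 1) 0 s0.
  rewrite subrKC exprn_gt0// => /(_ isT).
  rewrite expr0n /= mulr0 mul0r expR0 mulr1 sqrtr_sqr gtr0_norm// => Eq.
  rewrite [leRHS]EFinB leeBrDr// -Eq -ge0_integralZl//; last by rewrite lee_fin subr_ge0 ltW.
  have -> : 1%:E = (\int[normal_prob 0 s]_x (1 : R)%:E)%E.
    by rewrite integral_cst// mul1e; apply/esym; exact: probability_setT.
  rewrite -ge0_integralD//=; last 2 first.
  - by move=> x _; rewrite mule_ge0// lee_fin subr_ge0 ltW.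
  - exact: measurable_funeM.
  apply: ge0_le_integral => //=.
  - by move=> x _; apply: adde_ge0 => //; apply: mule_ge0 => //; rewrite lee_fin subr_ge0 ltW.
  - by apply: emeasurable_funD => //; exact: measurable_funeM.
  - apply/measurable_EFinP; apply: measurableT_comp => //.
    apply: measurable_funM => //; apply: measurable_funM => //.
    by apply: measurable_funX; exact: measurable_funD.
  - move=> x _; rewrite -EFinM -EFinD lee_fin add0r opprB mulrA [leLHS]addrC.
    exact: expR_ge1Dx.
have E0 : (0 <= E)%E by apply: integral_ge0.
have Efin : E \is a fin_num.
  rewrite ge0_fin_numE//.
  have := key 2^-1 ltac:(by apply/andP; split; lra).
  case: (E) E0 => [r _ _|_|//]; first exact: ltry.
  by rewrite gt0_muley ?lte_fin//; lra.
move: key E0; rewrite -(fineK Efin); set r := fine E => key; rewrite !lee_fin => r0.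
apply/ler_addgt0Pr => e e0.
(* With q = 1 - d, [key] reads r (2 - d) (1 - d) <= 1, so r <= 1/2 + 3 r d / 2. The choice of d
   makes the last term at most e. *)
pose q := 1 - Num.min 2^-1 (e / (3 * r + 1)).
set d := Num.min _ _ in q.
have d0 : 0 < d by rewrite /d lt_min invr_gt0 ltr0n divr_gt0//; lra.
have d2 : d <= 2^-1 by rewrite /d ge_min lexx.
have de : d * (3 * r + 1) <= e.
  by rewrite -ler_pdivlMr; [rewrite /d ge_min lexx orbT|lra].
have q01 : 0 < q < 1 by rewrite /q; apply/andP; split; lra.
have := key q q01; rewrite -EFinM lee_fin.
case/andP: q01 => q0 q1 h.
have : (1 - q ^+ 2) * r * q <= 1 - q.
  apply: le_trans (ler_wpM2r (ltW q0) h) _.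
  by rewrite mulrBl mulVf ?gt_eqF// mul1r.
have -> : 1 - q ^+ 2 = d * (2 - d) by rewrite /q; ring.
have -> : 1 - q = d by rewrite /q; ring.
rewrite -mulrA -mulrA -[leRHS]mulr1 ler_pM2l// /q.
have : 0 <= d * r by rewrite mulr_ge0// ltW.
have : 0 <= d ^+ 2 * r by rewrite mulr_ge0// sqr_ge0.
nra.
Qed.

(** * Integration against product measures on tuples *)

Lemma ge0_integral_tuple_prob_cons {R : realType} {d} {T : measurableType d} {n : nat}
    (mu : 'I_n.+1 -> probability T R) (f : n.+1.-tuple T -> \bar R) :
  measurable_fun setT f -> (forall t, 0 <= f t)%E ->
  (\int[tuple_prob mu]_t f t =
   \int[mu ord0]_x \int[tuple_prob (fun i => mu (lift ord0 i))]_t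
      f [tuple of x :: t])%E.
Proof.
move=> mf f0; rewrite ge0_integral_pushforward//.
rewrite preimage_setT fubini_tonelli1//; last by move=> x /=; exact: f0.
by apply: measurableT_comp => //; exact: measurable_cons.
Qed.

Lemma ge0_integral_tuple_prob_prod {R : realType} {d} {T : measurableType d} {n : nat}
    (mu : 'I_n -> probability T R) (f : 'I_n -> T -> R) :
  (forall i, measurable_fun setT (f i)) -> (forall i x, 0 <= f i x) ->
  (\int[tuple_prob mu]_t (\prod_i f i (tnth t i))%:E =
   \prod_i \int[mu i]_x (f i x)%:E)%E.
Proof.
elim: n mu f => [|n IH] mu f mf f0.
  rewrite big_ord0 (eq_integral (cst 1%E)) => [|t _]; last by rewrite big_ord0.
  by rewrite integral_cst// mul1e; exact: probability_setT.
rewrite ge0_integral_tuple_prob_cons; first last.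
- by move=> t; rewrite lee_fin prodr_ge0.
- apply/measurable_EFinP; apply: measurable_prod => i _.
  apply: (@measurableT_comp _ _ _ _ _ _ (f i)) => //.
  exact: measurable_tnth.
rewrite big_ord_recl -(IH _ (fun i => f (lift ord0 i)))//.
rewrite -ge0_integralZr//; first last.
- by apply: integral_ge0 => t _; rewrite lee_fin prodr_ge0.
- by move=> x _; rewrite lee_fin.
- exact/measurable_EFinP.
apply: eq_integral => x _.
rewrite -ge0_integralZl//; first last.
- by rewrite lee_fin.
- by move=> t _; rewrite lee_fin prodr_ge0.
- apply/measurable_EFinP; apply: measurable_prod => i _.
  apply: (@measurableT_comp _ _ _ _ _ _ (f (lift ord0 i))) => //.
  exact: measurable_tnth.
apply: eq_integral => t _; rewrite -EFinM big_ord_recl tnth0; congr (_ * _)%:E.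
by apply: eq_bigr => i _; rewrite tnthS.
Qed.

Lemma ge0_integral_tuple_prob_tnth {R : realType} {d} {T : measurableType d} {n : nat}
    (mu : 'I_n -> probability T R) (i : 'I_n) (f : T -> R) :
  measurable_fun setT f -> (forall x, 0 <= f x) ->
  (\int[tuple_prob mu]_t (f (tnth t i))%:E = \int[mu i]_x (f x)%:E)%E.
Proof.
move=> mf f0.
have := @ge0_integral_tuple_prob_prod R d T n mu (fun j => if j == i then f else cst 1).
rewrite [in RHS](bigD1 i)//= eqxx [X in (_ * X)%E]big1; last first.
  move=> j /negbTE ->; rewrite (eq_integral (cst 1%E))// integral_cst// mul1e; exact: probability_setT.
rewrite mule1 => <-; last 2 first.
- by move=> j; case: ifP.
- by move=> j x; case: ifP.
apply: eq_integral => t _; rewrite (bigD1 i)//= eqxx big1 ?mulr1// => j /negbTE -> //.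
Qed.

(** A singleton is the intersection of its coordinate preimages, and there are only finitely many
    points. *)
Lemma measurable_tuple_bool (n : nat) (A : set (n.-tuple bool)) : measurable A.
Proof.
have -> : A = \bigcup_(x in A) \bigcap_(i in [set: 'I_n])
    ((fun t : n.-tuple bool => tnth t i) @^-1` [set tnth x i]).
  apply/seteqP; split => [x Ax|t [x Ax tx]]; first by exists x.
  by rewrite (_ : t = x)//; apply: eq_from_tnth => i; exact: tx.
apply: fin_bigcup_measurable => // x _.
apply: fin_bigcap_measurable => // i _.
rewrite -[X in measurable X]setTI; exact: measurable_tnth.
Qed.

Lemma measurable_fun_tuple_bool d (T : measurableType d) (n : nat)
  (f : n.-tuple bool -> T) : measurable_fun setT f.
Proof. by move=> _ A _; exact: measurable_tuple_bool. Qed.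

Lemma integral_uniform_bits {R : realType} (n : nat) (f : n.-tuple bool -> R) :
  (forall x, 0 <= f x) ->
  (\int[tuple_prob (fun _ : 'I_n => bernoulli_prob (2^-1 : R))]_x (f x)%:E =
   (2^-1 ^+ n * \sum_x f x)%:E)%E.
Proof.
elim: n f => [|n IH] f f0.
  rewrite (big_pred1 [tuple]) => [|t]; last by rewrite /= tuple0; apply/esym/eqP.
  by rewrite integral_dirac ?diracT ?mul1e ?expr0 ?mul1r//; exact: measurable_fun_tuple_bool.
rewrite ge0_integral_tuple_prob_cons//; last exact: measurable_fun_tuple_bool.
under eq_integral => x _ do rewrite IH//.
rewrite integral_bernoulli_prob; last 2 first.
- by apply/andP; split; lra.
- by move=> x; rewrite lee_fin mulr_ge0// ?exprn_ge0// sumr_ge0.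
rewrite -!EFinM -EFinD sum_tuple_cons big_split /= /unstable.onem; congr EFin.
rewrite exprS; set A := \sum_t _; set B := \sum_t _; by field.
Qed.

(** * The Donsker-Varadhan bound *)

(* Donsker-Varadhan bound with test function -h: integrate
   ln r >= - h - ln Z + 1 - exp (- h) / (Z r), where r = dmu/dnu. *)
Lemma kl_divergence_ge {R : realType} {d} {T : measurableType d}
    (mu nu : probability T R) (h : T -> R) (M Z : R) :
  measurable_fun setT h -> (forall x, 0 <= h x) -> 0 < Z ->
  (\int[mu]_x (h x)%:E <= M%:E)%E ->
  (\int[nu]_x (expR (- h x))%:E <= Z%:E)%E ->
  (((- M - ln Z) / ln 2)%:E <= kl_divergence mu nu)%E.
Proof.
move=> mh h0 Z0 hM hZ; rewrite /kl_divergence; case: asboolP => [dom|_]; last exact: leey.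
set dr := Radon_Nikodym _ _.
pose r x := fine (dr x).
have mdr : measurable_fun setT dr by apply: (@measurable_int _ _ _ nu); apply: Radon_Nikodym_integrable.
have rE x : (r x)%:E = dr x by rewrite fineK// Radon_Nikodym_fin_num.
have mr : measurable_fun setT r.
  by apply/measurable_EFinP; rewrite (_ : EFin \o r = dr)//; apply/funext => x /=.
pose D := r @^-1` `]0, +oo[.
have mD : measurable D by rewrite -[D]setTI; exact: mr.
have mDC : measurable (~` D) by exact: measurableC.
have Dr x : D x -> 0 < r x by rewrite /D /= in_itv/= andbT.
have nDr x : ~ D x -> r x <= 0 by rewrite /D /= in_itv/= andbT => /negP; rewrite -leNgt.
(* Off D the logarithm of r is a default value; since [mu] does not charge that set, pointwise
   bounds are needed only on D. *)
have muD : mu (~` D) = 0%E.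
  apply/eqP; rewrite eq_le measure_ge0 andbT.
  have -> : mu (~` D) = (\int[nu]_(x in ~` D) dr x)%E.
    rewrite -Radon_Nikodym_integral//; exact: measurableC.
  rewrite -[leLHS]oppeK leeNl oppe0 -integralN; last first.
    apply: integrable_add_def => //; apply: (integrableS measurableT) => //.
    exact: Radon_Nikodym_integrable.
  by apply: integral_ge0 => x /nDr; rewrite -rE -EFinN lee_fin oppr_ge0.
(* On D this is exp (- h) / (Z r), written as one exponential so that 1 + u <= exp u applies to its
   exponent. *)
pose w x := \1_D x * expR (- h x - ln Z - ln (r x)).
have w0 x : 0 <= w x by rewrite mulr_ge0 ?expR_ge0// indicE.
have mw : measurable_fun setT w.
  apply: measurable_funM; first exact: measurable_indic.
  apply: measurableT_comp => //; apply: measurable_funB.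
    by apply: measurable_funB => //; exact: measurableT_comp.
  exact: (@measurableT_comp _ _ _ _ _ _ (@ln R)).
have me : measurable_fun setT (fun x => (expR (- h x))%:E).
  by apply/measurable_EFinP; apply: measurableT_comp => //; exact: measurableT_comp.
(* Passing from [mu] to [nu] multiplies by r, and w r = exp (- h) / Z on D. *)
have w1 : (\int[mu]_x (w x)%:E <= 1)%E.
  rewrite -(Radon_Nikodym_SigmaFinite.change_of_variables dom)//; last exact/measurable_EFinP.
  have -> : (\int[nu]_x ((w x)%:E * Radon_Nikodym_SigmaFinite.f mu nu x) =
             \int[nu]_x ((w x)%:E * dr x))%E.
    apply: ae_eq_integral => //.
    - apply: emeasurable_funM; first exact/measurable_EFinP.
      exact: measurable_int _ (Radon_Nikodym_SigmaFinite.f_integrable dom).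
    - by apply: emeasurable_funM => //; exact/measurable_EFinP.
    - by apply: ae_eqe_mul2l; exact: ae_eq_Radon_Nikodym_SigmaFinite.
  apply: (@le_trans _ _ (\int[nu]_x ((Z^-1)%:E * (expR (- h x))%:E))%E).
    apply: ge0_le_integral => //.
    - move=> x _; rewrite -rE -EFinM lee_fin /w indicE.
      case: (boolP (x \in D)) => [/set_mem/Dr rx|]; last by rewrite !mul0r.
      by rewrite mul1r mulr_ge0 ?expR_ge0// ltW.
    - by apply: emeasurable_funM => //; exact/measurable_EFinP.
    - exact: measurable_funeM.
    - move=> x _; rewrite -rE -!EFinM lee_fin /w indicE.
      case: (boolP (x \in D)) => [/set_mem/Dr rx|_]; last first.
        by rewrite !mul0r mulr_ge0 ?expR_ge0// invr_ge0 ltW.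
      by rewrite mul1r !expRD !expRN !lnK ?posrE// mulfVK ?gt_eqF// mulrC.
  rewrite ge0_integralZl//; last by rewrite lee_fin invr_ge0 ltW.
  apply: (le_trans (lee_wpmul2l _ hZ)); first by rewrite lee_fin invr_ge0 ltW.
  by rewrite -EFinM mulVf// gt_eqF.
have ln20 : 0 < ln 2 :> R by rewrite ln_gt0// ltr1n.
pose L x := (ln 2)^-1 * ((1 - ln Z) - h x - w x).
have int_nonneg (g : T -> R) (C : R) : measurable_fun setT g -> (forall x, 0 <= g x) ->
    (\int[mu]_x (g x)%:E <= C%:E)%E -> mu.-integrable setT (EFin \o g).
  move=> mg g0 gC; apply/integrableP; split; first exact/measurable_EFinP.
  under eq_integral => x _ do rewrite /= ger0_norm//.
  exact: le_lt_trans gC (ltry _).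
have ih := int_nonneg _ _ mh h0 hM.
have iw := int_nonneg _ _ mw w0 w1.
have ic : mu.-integrable setT (fun=> (1 - ln Z)%:E).
  exact: (finite_measure_integrable_cst mu).
have ichw : mu.-integrable setT (fun x => (1 - ln Z)%:E - (h x)%:E - (w x)%:E)%E.
  by apply: integrableB => //; exact: integrableB.
have intL : (((- M - ln Z) / ln 2)%:E <= \int[mu]_x (L x)%:E)%E.
  under eq_integral => x _ do rewrite /L EFinM !EFinB.
  rewrite integralZl//.
  rewrite mulrC EFinM; apply: lee_wpmul2l; first by rewrite lee_fin invr_ge0 ltW.
  rewrite integralB//; last exact: integrableB.
  rewrite integralB// integral_cst//= probability_setT mule1.
  rewrite (_ : - M - ln Z = (1 - ln Z) - M - 1); last by ring.
  rewrite !EFinB; by apply: leeB => //; apply: leeB.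
apply: (le_trans intL).
have mlog : measurable_fun setT (fun x => (log2 (r x))%:E).
  apply/measurable_EFinP; apply: measurable_funM => //.
  by apply: (@measurableT_comp _ _ _ _ _ _ (@ln R)).
have mL : measurable_fun setT (fun x => (L x)%:E).
  apply/measurable_EFinP; apply: measurable_funM => //.
  by apply: measurable_funB => //; exact: measurable_funB.
have LD x : D x -> L x <= log2 (r x).
  move=> Dx; have rx := Dr x Dx.
  rewrite /L /log2 mulrC ler_wpM2r ?invr_ge0 ?(ltW ln20)// /w indicE mem_set// mul1r.
  by have := expR_ge1Dx (- h x - ln Z - ln (r x)); lra.
have aeD : {ae mu, forall x, setT x -> D x}.
  exists (~` D); split => //.
  by move=> x nDx Dx; exact: (nDx (fun _ => Dx)).
(* Integrability of log r is not known, so positive and negative parts are compared separately. *)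
rewrite [leLHS]integralE [leRHS]integralE; apply: leeB.
- apply: ae_ge0_le_integral => //; [exact: measurable_funepos|exact: measurable_funepos|].
  apply: filterS aeD => x /= /(_ I) /LD Lx _.
  by rewrite !funeposE le_max2// lee_fin.
- apply: ae_ge0_le_integral => //; [exact: measurable_funeneg|exact: measurable_funeneg|].
  apply: filterS aeD => x /= /(_ I) /LD Lx _.
  by rewrite !funenegE le_max2// leeN2 lee_fin.
Qed.

(** * Mutual information of a fixed channel *)

Lemma integral_probability_cst {R : realType} d (T : measurableType d)
    (P : probability T R) (c : \bar R) : (\int[P]_x c = c)%E.
Proof.
rewrite (integral_cst P measurableT c) [X in (_ * X)%E](_ : _ = 1%E) ?mule1//.
exact: probability_setT.
Qed.

Section mutual_information_lower_bound.
Context {R : realType} {m n : nat} (sigma gamma : R) (A : 'M[R]_(m, n)).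
Hypotheses (sigma_gt0 : 0 < sigma) (gamma_gt0 : 0 < gamma).

Local Notation RR := (measurableTypeR R).
Local Notation law :=
  (channel_law m sigma (fun _ : 'I_n => bernoulli_prob (2^-1 : R))).

Definition noiseless_output (x : n.-tuple bool) (i : 'I_m) : R :=
  ((Num.sqrt m%:R)^-1 *: (A *m signs x)) i 0.

(** The function h of [kl_divergence_ge]. The parameter [gamma] stays free until the final
    infimum. *)
Definition scaled_residual (z : n.-tuple bool * m.-tuple RR) : R :=
  \sum_i gamma * (tnth z.2 i - noiseless_output z.1 i) ^+ 2 / (2 * sigma ^+ 2).

(** This is 4^n F(A): the uniform weights of the two inputs are left out. *)
Definition pairwise_exponent_sum : R :=
  \sum_(x : n.-tuple bool) \sum_(x' : n.-tuple bool) \prod_(i < m)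
    ((Num.sqrt (1 + gamma))^-1 * expR (- (gamma / (1 + gamma)) *
       (noiseless_output x' i - noiseless_output x i) ^+ 2 / (2 * sigma ^+ 2))).

Let measurable_noiseless i d (T : measurableType d) (f : T -> n.-tuple bool) :
  measurable_fun setT f -> measurable_fun setT (fun t => noiseless_output (f t) i).
Proof.
move=> mf; apply: (@measurableT_comp _ _ _ _ _ _ (fun x => noiseless_output x i)) => //.
exact: measurable_fun_tuple_bool.
Qed.

Let measurable_tnth_comp i d (T : measurableType d) (f : T -> m.-tuple RR) :
  measurable_fun setT f -> measurable_fun setT (fun t => tnth (f t) i : RR).
Proof.
move=> mf; apply: (@measurableT_comp _ _ _ _ _ _ (fun t : m.-tuple RR => tnth t i)) => //.
exact: measurable_tnth.
Qed.

Lemma measurable_scaled_residual : measurable_fun setT scaled_residual.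
Proof.
apply: measurable_sum => i; apply: measurable_funM => //; apply: measurable_funM => //.
apply: measurable_funX; apply: measurable_funB.
  exact: measurable_tnth_comp.
exact: measurable_noiseless.
Qed.

Lemma scaled_residual_ge0 z : 0 <= scaled_residual z.
Proof.
apply: sumr_ge0 => i _; rewrite divr_ge0//.
  by rewrite mulr_ge0 ?sqr_ge0// ltW.
by rewrite mulr_ge0// sqr_ge0.
Qed.

Lemma scaled_residual_output x (w : n.-tuple bool * m.-tuple RR) :
  scaled_residual (x, channel_output A w) =
  \sum_i gamma * ((noiseless_output w.1 i - noiseless_output x i) + tnth w.2 i) ^+ 2 / (2 * sigma ^+ 2).
Proof.
apply: eq_bigr => i _; rewrite /channel_output/= tnth_mktuple -/(noiseless_output w.1 i).
by congr (_ * _ ^+ 2 / _); ring.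
Qed.

(** Under the joint law the residual is the noise alone, and each of the m coordinates contributes
    at most [gamma] / 2. *)
Lemma integral_joint_residual_le :
  (\int[distribution law (rv_pair (@channel_input R m n) (channel_output A))]_z
     (scaled_residual z)%:E <= (gamma * m%:R / 2)%:E)%E.
Proof.
have mr : measurable_fun setT (fun z => (scaled_residual z)%:E).
  by apply/measurable_EFinP; exact: measurable_scaled_residual.
rewrite ge0_integral_pushforward//; last by move=> z _; rewrite lee_fin scaled_residual_ge0.
rewrite preimage_setT.
under eq_integral => w _.
  rewrite /= /rv_pair scaled_residual_output.
  under eq_bigr => i _ do rewrite subrr add0r.
  over.
have mN : measurable_fun setT (fun t : m.-tuple RR =>
    (\sum_i gamma * tnth t i ^+ 2 / (2 * sigma ^+ 2))%:E).
  apply/measurable_EFinP; apply: measurable_sum => i.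
  apply: measurable_funM => //; apply: measurable_funM => //.
  by apply: measurable_funX; exact: measurable_tnth_comp.
have g0 (y : R) : 0 <= gamma * y ^+ 2 / (2 * sigma ^+ 2).
  rewrite divr_ge0//; first by rewrite mulr_ge0 ?sqr_ge0// ltW.
  by rewrite mulr_ge0// sqr_ge0.
rewrite fubini_tonelli1 /fubini_F/=; last 2 first.
- exact: (measurableT_comp mN).
- by move=> w; rewrite lee_fin sumr_ge0.
rewrite integral_probability_cst.
under eq_integral => t _ do rewrite -sumEFin.
rewrite ge0_integral_sum//; last 2 first.
- move=> i; apply/measurable_EFinP.
  apply: measurable_funM => //; apply: measurable_funM => //.
  by apply: measurable_funX; exact: measurable_tnth_comp.
- by move=> i t _; rewrite lee_fin.
apply: (@le_trans _ _ (\sum_(i < m) (gamma / 2)%:E)%E); last first.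
  by rewrite sumEFin lee_fin sumr_const card_ord -[leLHS]mulr_natr mulrAC.
apply: lee_sum => i _.
rewrite (ge0_integral_tuple_prob_tnth (fun=> normal_prob 0 sigma) i
  (fun y : RR => gamma * y ^+ 2 / (2 * sigma ^+ 2)))//; last first.
  by apply: measurable_funM => //; apply: measurable_funM => //; exact: measurable_funX.
under eq_integral => y _ do rewrite -mulrA EFinM.
rewrite ge0_integralZl//.
- rewrite EFinM; apply: lee_wpmul2l; first by rewrite lee_fin ltW.
  exact: integral_normal_sqr_le.
- by apply/measurable_EFinP; apply: measurable_funM => //; exact: measurable_funX.
- move=> y _; rewrite lee_fin divr_ge0 ?sqr_ge0//.
  by rewrite mulr_ge0// sqr_ge0.
- by rewrite lee_fin ltW.
Qed.

(** Under the product law the output comes from an independent input x', so coordinate i of the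
    residual is the noise shifted by the difference of the noiseless outputs. Independence of the
    noise coordinates gives a product of Gaussian integrals. *)
Lemma integral_product_residual :
  (\int[distribution law (@channel_input R m n) \x distribution law (channel_output A)]_z
     (expR (- scaled_residual z))%:E =
   (2^-1 ^+ n * (2^-1 ^+ n * pairwise_exponent_sum))%:E)%E.
Proof.
have me : measurable_fun setT (fun z => (expR (- scaled_residual z))%:E).
  apply/measurable_EFinP; apply: measurableT_comp => //.
  by apply: measurableT_comp => //; exact: measurable_scaled_residual.
rewrite fubini_tonelli1//.
rewrite ge0_integral_pushforward//; last 2 first.
- exact: measurable_fun_fubini_tonelli_F.
- by move=> x _; apply: integral_ge0 => y _; rewrite lee_fin expR_ge0.
rewrite preimage_setT.
pose G x : R := 2^-1 ^+ n * \sum_(x' : n.-tuple bool) \prod_(i < m)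
    ((Num.sqrt (1 + gamma))^-1 * expR (- (gamma / (1 + gamma)) *
       (noiseless_output x' i - noiseless_output x i) ^+ 2 / (2 * sigma ^+ 2))).
have p0 (x x' : n.-tuple bool) : 0 <= \prod_(i < m)
    ((Num.sqrt (1 + gamma))^-1 * expR (- (gamma / (1 + gamma)) *
       (noiseless_output x' i - noiseless_output x i) ^+ 2 / (2 * sigma ^+ 2))).
  by apply: prodr_ge0 => i _; rewrite mulr_ge0 ?expR_ge0// invr_ge0 sqrtr_ge0.
have G0 x : 0 <= G x by rewrite mulr_ge0 ?exprn_ge0// sumr_ge0.
have inner x : fubini_F (distribution law (channel_output A))
    (fun z => (expR (- scaled_residual z))%:E) x = (G x)%:E.
  rewrite /fubini_F ge0_integral_pushforward//; last first.
    by apply: (measurableT_comp me); exact: measurable_fun_pair.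
  rewrite preimage_setT.
  rewrite fubini_tonelli1 /fubini_F/=; last 2 first.
  - apply: (measurableT_comp me); apply: measurable_fun_pair => //.
  - by move=> w; rewrite lee_fin expR_ge0.
  rewrite -integral_uniform_bits//; apply: eq_integral => x' _.
  under eq_integral => t _.
    rewrite scaled_residual_output /= -sumrN expR_sum.
    under eq_bigr => i _ do rewrite -mulNr -mulNr.
    over.
  rewrite (ge0_integral_tuple_prob_prod (fun=> normal_prob 0 sigma)
    (fun i (y : RR) => expR (- gamma *
      (noiseless_output x' i - noiseless_output x i + y) ^+ 2 / (2 * sigma ^+ 2))))//; last first.
    move=> i; apply: measurableT_comp => //.
    apply: measurable_funM => //; apply: measurable_funM => //.
    by apply: measurable_funX; exact: measurable_funD.
  rewrite -prodEFin; apply: eq_bigr => i _.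
  by rewrite integral_normal_expR// addr_gt0.
under eq_integral => w _ do rewrite /= inner.
rewrite fubini_tonelli1 /fubini_F/=; last 2 first.
- by apply/measurable_EFinP; apply: (@measurableT_comp _ _ _ _ _ _ G) => //; exact: measurable_fun_tuple_bool.
- by move=> w; rewrite lee_fin.
under eq_integral => x _ do rewrite integral_probability_cst.
rewrite integral_uniform_bits//; congr (_ * _)%:E.
by rewrite /G -mulr_sumr.
Qed.

Lemma pairwise_exponent_sum_gt0 : 0 < pairwise_exponent_sum.
Proof.
have p0 (x x' : n.-tuple bool) : 0 < \prod_(i < m)
    ((Num.sqrt (1 + gamma))^-1 * expR (- (gamma / (1 + gamma)) *
       (noiseless_output x' i - noiseless_output x i) ^+ 2 / (2 * sigma ^+ 2))).
  by apply: prodr_gt0 => i _; rewrite mulr_gt0 ?expR_gt0// invr_gt0 sqrtr_gt0 addr_gt0.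
pose x0 := [tuple of nseq n false].
rewrite /pairwise_exponent_sum (bigD1 x0)//= ltr_pwDl//.
  by rewrite (bigD1 x0)//= ltr_pwDl// sumr_ge0// => x _; exact: ltW.
by apply: sumr_ge0 => x _; apply: sumr_ge0 => x' _; exact: ltW.
Qed.

Lemma mutual_information_uniform_ge :
  (((- (gamma * m%:R / 2) -
     ln (2^-1 ^+ n * (2^-1 ^+ n * pairwise_exponent_sum))) / ln 2)%:E <=
   mutual_information law (@channel_input R m n) (channel_output A))%E.
Proof.
apply: (kl_divergence_ge _ _ scaled_residual).
- exact: measurable_scaled_residual.
- exact: scaled_residual_ge0.
- by rewrite !mulr_gt0 ?exprn_gt0 ?pairwise_exponent_sum_gt0.
- exact: integral_joint_residual_le.
- by rewrite integral_product_residual.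
Qed.

End mutual_information_lower_bound.

(** * Averaging over sign matrices *)

Lemma sum_tuple_prod {R : comRingType} (n : nat) (f : 'I_n -> bool -> R) :
  \sum_(t : n.-tuple bool) \prod_j f j (tnth t j) = \prod_j (f j false + f j true).
Proof.
elim: n f => [|n IH] f.
  rewrite (big_pred1 [tuple]) => [|t]; last by rewrite /= tuple0; apply/esym/eqP.
  by rewrite !big_ord0.
rewrite sum_tuple_cons [RHS]big_ord_recl -(IH (fun j => f (lift ord0 j))) mulr_sumr.
apply: eq_bigr => t _; rewrite !big_ord_recl !tnth0 mulrDl.
by congr (_ * _ + _ * _); apply: eq_bigr => j _; rewrite tnthS.
Qed.

Definition hamming {n : nat} (x y : n.-tuple bool) : nat :=
  #|[pred j | tnth y j != tnth x j]|.

Lemma hamming_le {n : nat} (x y : n.-tuple bool) : (hamming x y <= n)%N.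
Proof. by rewrite -[leqRHS]card_ord max_card. Qed.

(** For a probability p the terms are the masses of the random string obtained from x by flipping
    each bit independently with probability p. *)
Lemma sum_hamming_binomial {R : comRingType} {n : nat} (x : n.-tuple bool) (p : R) :
  \sum_(y : n.-tuple bool) p ^+ hamming x y * (1 - p) ^+ (n - hamming x y) = 1.
Proof.
pose f j b := if b != tnth x j then p else 1 - p.
transitivity (\sum_(y : n.-tuple bool) \prod_j f j (tnth y j)).
  apply: eq_bigr => y _ /=.
  rewrite big_if /= !prodr_const; congr (_ * _ ^+ _).
  rewrite -[X in (X - _)%N](card_ord n) /hamming -(cardC [pred j | tnth y j != tnth x j]) addKn.
  by apply: eq_card => j; rewrite !inE.
rewrite (sum_tuple_prod _ f) big1// /f => j _ /=.
by case: (tnth x j) => /=; rewrite ?subrKC ?subrK// addrC subrK.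
Qed.

Lemma expR_entropy {R : realType} {n : nat} (d : nat) : (0 < n)%N -> (d <= n)%N ->
  expR (- (n%:R * (ln 2 * binary_entropy (d%:R / n%:R : R)))) =
  (d%:R / n%:R) ^+ d * (1 - d%:R / n%:R) ^+ (n - d).
Proof.
move=> n0 dn; have nR : 0 < n%:R :> R by rewrite ltr0n.
have ln20 : ln 2 != 0 :> R by rewrite gt_eqF// ln_gt0// ltr1n.
(* The case k = 0 covers d = 0 and d = n, where [ln] is evaluated at 0 but multiplied by 0. *)
have powE (k : nat) (t : R) : (k == 0)%N || (0 < t) -> expR (k%:R * ln t) = t ^+ k.
  by move=> /orP[/eqP->|t0]; rewrite ?mul0r ?expR0// expRM_natl lnK.
rewrite -powE; last by case: d dn => //= d dn; rewrite divr_gt0// ltr0n.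
have tE : 1 - d%:R / n%:R = (n - d)%:R / n%:R :> R.
  by rewrite natrB// mulrBl divff// gt_eqF.
rewrite -powE; last first.
  by rewrite tE; case: (n - d)%N => //= k; rewrite divr_gt0// ltr0n.
rewrite -expRD /binary_entropy /log2 natrB//; congr expR.
by field; rewrite ln20 gt_eqF.
Qed.

(* The term with index d = hamming x y of the binomial sums with parameters
   p = d / n is exp (- n ln 2 H(d / n)). *)
Lemma sum_expR_entropy_le {R : realType} {n : nat} (x : n.-tuple bool) : (0 < n)%N ->
  \sum_(y : n.-tuple bool)
    expR (- (n%:R * (ln 2 * binary_entropy ((hamming x y)%:R / n%:R : R)))) <= n.+1%:R.
Proof.
move=> n0.
apply: (@le_trans _ _ (\sum_(y : n.-tuple bool) \sum_(d < n.+1)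
    (d%:R / n%:R : R) ^+ hamming x y * (1 - d%:R / n%:R) ^+ (n - hamming x y))).
  apply: ler_sum => y _; rewrite expR_entropy ?hamming_le//.
  have hy : (hamming x y < n.+1)%N by rewrite ltnS hamming_le.
  rewrite (bigD1 (Ordinal hy))//= lerDl sumr_ge0// => d _.
  rewrite mulr_ge0// ?exprn_ge0 ?divr_ge0// subr_ge0 ler_pdivrMr ?ltr0n// mul1r.
  by rewrite ler_nat -ltnS.
rewrite exchange_big /= (eq_bigr (fun=> 1)) => [|d _]; last exact: sum_hamming_binomial.
by rewrite sumr_const card_ord.
Qed.

Section random_sign_matrix.
Context {R : realType} (m n : nat) (sigma beta gamma : R).
Hypotheses (m_gt0 : (0 < m)%N) (n_gt0 : (0 < n)%N) (sigma_gt0 : 0 < sigma).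
Hypotheses (gamma_gt0 : 0 < gamma) (nm_beta : n%:R / m%:R = beta).

(** L / m is the coefficient l of the exponential moment bound, including a factor 4 from halving
    the sign differences. The hypothesis [m_large] is then 2 l < 1. *)
Let L := 2 * gamma / (sigma ^+ 2 * (1 + gamma)).
Hypothesis m_large : 2 * L < m%:R.

(** Indexing sign matrices by functions from rows to bit strings lets sums over matrices factor over
    the rows. *)
Definition matrix_of_rows (B : {ffun 'I_m -> n.-tuple bool}) : 'M[R]_(m, n) :=
  \matrix_(i, j) (-1) ^+ tnth (B i) j.

Lemma sign_matrix_of_rows B : sign_matrix (matrix_of_rows B).
Proof.
by move=> i j; rewrite mxE; case: (tnth _ _); [right; rewrite expr1|left; rewrite expr0].
Qed.

(** Halving puts the entries in {0, 1, -1}, as [rademacher_expR_sqr_le] requires; the nonzero ones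
    are counted by the Hamming distance. *)
Let halfdiff (x x' : n.-tuple bool) (j : 'I_n) : R :=
  ((-1) ^+ tnth x' j - (-1) ^+ tnth x j) / 2.

Let rowterm (x x' r : n.-tuple bool) : R :=
  (Num.sqrt (1 + gamma))^-1 *
  expR (- (L / m%:R) * (\sum_j (-1) ^+ tnth r j * halfdiff x x' j) ^+ 2).

Let mR : 0 < m%:R :> R. Proof. by rewrite ltr0n. Qed.
Let nR : 0 < n%:R :> R. Proof. by rewrite ltr0n. Qed.

Let L_gt0 : 0 < L.
Proof. by rewrite divr_gt0 ?mulr_gt0 ?exprn_gt0 ?addr_gt0. Qed.

Lemma pairwise_exponent_sum_rows B :
  pairwise_exponent_sum sigma gamma (matrix_of_rows B) =
  \sum_x \sum_x' \prod_(i < m) rowterm x x' (B i).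
Proof.
apply: eq_bigr => x _; apply: eq_bigr => x' _; apply: eq_bigr => i _.
congr (_ * expR _).
have -> : noiseless_output (matrix_of_rows B) x' i - noiseless_output (matrix_of_rows B) x i =
    (Num.sqrt m%:R)^-1 * (2 * \sum_j (-1) ^+ tnth (B i) j * halfdiff x x' j).
  rewrite /noiseless_output !mxE -mulrBr; congr (_ * _).
  rewrite -sumrB mulr_sumr; apply: eq_bigr => j _.
  by rewrite !mxE /halfdiff; field.
rewrite exprMn exprVn sqr_sqrtr ?ler0n// /L; field.
by rewrite !gt_eqF// addr_gt0.
Qed.

Lemma rowterm_average_le x x' :
  2^-1 ^+ n * \sum_r rowterm x x' r <=
  (Num.sqrt (1 + gamma))^-1 * expR (- ((1 - 2 * (L / m%:R)) / 2) *
    ln (1 + 2 * (L / m%:R) * (hamming x x')%:R)).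
Proof.
rewrite -mulr_sumr mulrCA ler_wpM2l ?invr_ge0 ?sqrtr_ge0//.
have -> : (hamming x x')%:R = \sum_j (halfdiff x x' j != 0)%:R :> R.
  rewrite -natr_sum /hamming -sum1_card big_mkcond /=; congr (_%:R).
  apply: eq_bigr => j _; rewrite /halfdiff inE mulf_eq0 invr_eq0 pnatr_eq0 orbF subr_eq0.
  by rewrite (inj_eq (@signr_inj R)); case: eqP.
apply: rademacher_expR_sqr_le.
- by rewrite divr_ge0// ltW.
- by rewrite mulrA ltr_pdivrMr// mul1r.
- move=> j; rewrite /halfdiff; case: (tnth x j); case: (tnth x' j); rewrite ?expr0 ?expr1.
  + by left; rewrite subrr mul0r.
  + by right; left; field.
  + by right; right; field.
  + by left; rewrite subrr mul0r.
Qed.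

Variable S : R.
Hypothesis S_ge : forall t : R, 0 <= t <= 1 ->
  binary_entropy t + (2 * beta)^-1 * (gamma * log2 (expR 1) -
    log2 (1 + gamma / sigma ^+ 2 * (sigma ^+ 2 + 4 * t * beta))) <= S.

(** Using the exponent (1 - 2 l) / 2 instead of 1 / 2 costs m l ln (1 + 2 l d) over m rows. As m l =
    L and d <= n, this is at most K, which depends on m and n only through [beta]. *)
Let K := L * ln (1 + 2 * L * beta).

Lemma rowterm_average_exp_le (x x' : n.-tuple bool) :
  ((Num.sqrt (1 + gamma))^-1 * expR (- ((1 - 2 * (L / m%:R)) / 2) *
    ln (1 + 2 * (L / m%:R) * (hamming x x')%:R))) ^+ m <=
  expR (n%:R * (S * ln 2) - m%:R * gamma / 2 + K) *
  expR (- (n%:R * (ln 2 * binary_entropy ((hamming x x')%:R / n%:R)))).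
Proof.
set d := hamming x x'; set t := d%:R / n%:R.
have d0 : 0 <= d%:R :> R by [].
have g1 : 0 < 1 + gamma by rewrite addr_gt0.
have t01 : 0 <= t <= 1.
  by rewrite /t divr_ge0//= ler_pdivrMr// mul1r ler_nat hamming_le.
have beta0 : 0 < beta by rewrite -nm_beta divr_gt0.
have ln20 : 0 < ln 2 :> R by rewrite ln_gt0// ltr1n.
set a := 1 + 2 * (L / m%:R) * d%:R.
have a1 : 1 <= a by rewrite lerDl mulr_ge0// mulr_ge0// divr_ge0// ltW.
have a0 : 0 < a by apply: lt_le_trans a1.
have sq : (Num.sqrt (1 + gamma))^-1 = expR (- (ln (1 + gamma) / 2)).
  rewrite expRN; congr (_^-1).
  apply: (@pexpIrn _ 2); rewrite ?nnegrE ?sqrtr_ge0 ?expR_ge0//.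
  rewrite sqr_sqrtr ?ltW// -expRM_natl mulrC divfK// lnK//.
rewrite sq -!expRD -[_ ^+ m]expRM_natl ler_expR.
(* At t = d / n the argument of the logarithm in the theorem splits as (1 + gamma) (1 + 2 l d). *)
have prodE : ln (1 + gamma / sigma ^+ 2 * (sigma ^+ 2 + 4 * t * beta)) = ln (1 + gamma) + ln a.
  rewrite -lnM ?posrE//; congr ln.
  by rewrite /a /t /L -nm_beta; field; rewrite !gt_eqF.
have := S_ge t t01; rewrite /log2 expRK prodE.
move: (binary_entropy t) => H.
have lnaK : L * ln a <= K.
  rewrite /K ler_pM2l// ler_ln ?posrE//; last first.
    have Lb : 0 < L * beta by rewrite mulr_gt0.
    by rewrite addr_gt0// -mulrA mulr_gt0.
  rewrite /a lerD2l (_ : 2 * (L / m%:R) * d%:R = 2 * L * (d%:R / m%:R)); last first.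
    by field; rewrite gt_eqF.
  have L2 : 0 < 2 * L by rewrite mulr_gt0.
  rewrite ler_pM2l//. rewrite -nm_beta ler_pM2r ?invr_gt0// ler_nat.
  exact: hamming_le.
move: lnaK; move: (ln a) (ln (1 + gamma)) => A G lnaK hS.
(* Scaling by n ln 2 passes from bits to nats, and n / (2 beta) = m / 2. *)
have : n%:R * ln 2 * (H + (2 * beta)^-1 * (gamma * (1 / ln 2) - (G + A) / ln 2)) <=
       n%:R * ln 2 * S by rewrite ler_pM2l// mulr_gt0.
have -> : n%:R * ln 2 * (H + (2 * beta)^-1 * (gamma * (1 / ln 2) - (G + A) / ln 2)) =
   n%:R * (ln 2 * H) + m%:R * gamma / 2 - m%:R * (G + A) / 2.
  by rewrite -nm_beta; field; rewrite !gt_eqF.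
have -> : m%:R * (- (G / 2) + - ((1 - 2 * (L / m%:R)) / 2) * A) =
   - (m%:R * (G + A) / 2) + L * A.
  by field; rewrite gt_eqF.
have -> : n%:R * ln 2 * S = n%:R * (S * ln 2) by ring.
lra.
Qed.

(** First moment argument: the right side bounds the average over B. The sum over x' yields n + 1
    through the entropy bound, and the sum over x yields 2^n. *)
Lemma exists_pairwise_exponent_sum_le : exists B,
  pairwise_exponent_sum sigma gamma (matrix_of_rows B) <=
  2 ^+ n * (n.+1%:R * expR (n%:R * (S * ln 2) - m%:R * gamma / 2 + K)).
Proof.
set U := 2 ^+ n * _.
apply: contrapT => /forallNP noB.
have gtU B : U < pairwise_exponent_sum sigma gamma (matrix_of_rows B).
  by rewrite ltNge; apply/negP; exact: noB.
suff : \sum_(B : {ffun 'I_m -> n.-tuple bool})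
    pairwise_exponent_sum sigma gamma (matrix_of_rows B) <=
    \sum_(B : {ffun 'I_m -> n.-tuple bool}) U.
  apply/negP; rewrite -ltNge.
  (* One explicit index makes the inequality between the sums strict. *)
  pose B0 := [ffun _ : 'I_m => [tuple of nseq n false]].
  rewrite (bigD1 B0)//= [ltRHS](bigD1 B0)//= ltr_leD// ler_sum// => B _.
  exact: ltW.
(* For fixed x and x', the sum over B of a product over rows is the m-th power of the sum over a
   single row. *)
under eq_bigr => B _ do rewrite pairwise_exponent_sum_rows.
rewrite exchange_big/=.
under eq_bigr => x _.
  rewrite exchange_big /=.
  under eq_bigr => x' _ do rewrite -(bigA_distr_bigA (fun _ r => rowterm x x' r)) prodr_const card_ord.
  over.
rewrite sumr_const card_ffun card_tuple card_bool card_ord -mulr_natl.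
have card_pos : 0 < (2 ^+ n) ^+ m :> R by rewrite !exprn_gt0.
rewrite natrX natrX -ler_pdivrMl// mulr_sumr.
apply: (@le_trans _ _ (\sum_(x : n.-tuple bool)
   n.+1%:R * expR (n%:R * (S * ln 2) - m%:R * gamma / 2 + K))).
  apply: ler_sum => x _; rewrite mulr_sumr.
  apply: (@le_trans _ _ (\sum_(x' : n.-tuple bool)
     expR (n%:R * (S * ln 2) - m%:R * gamma / 2 + K) *
     expR (- (n%:R * (ln 2 * binary_entropy ((hamming x x')%:R / n%:R)))))).
    apply: ler_sum => x' _; apply: le_trans (rowterm_average_exp_le x x').
    rewrite -exprVn -exprMn -exprVn lerXn2r ?nnegrE ?rowterm_average_le//.
    rewrite mulr_ge0 ?exprn_ge0// sumr_ge0// => r _.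
    by rewrite mulr_ge0 ?expR_ge0// invr_ge0 sqrtr_ge0.
  by rewrite -mulr_sumr mulrC ler_wpM2r ?expR_ge0// sum_expR_entropy_le.
by rewrite sumr_const card_tuple card_bool -[leLHS]mulr_natl natrX.
Qed.

(** The term m gamma / 2 from the divergence bound cancels against the one in the matrix estimate;
    dividing by n ln 2 leaves the stated error. *)
Lemma normalized_capacity_ge :
  ((1 - S - (ln n.+1%:R + K) / (n%:R * ln 2))%:E <= normalized_capacity m n sigma)%E.
Proof.
have [B hB] := exists_pairwise_exponent_sum_le.
set P := pairwise_exponent_sum _ _ _ in hB.
have ln20 : 0 < ln 2 :> R by rewrite ln_gt0// ltr1n.
have MI := @mutual_information_uniform_ge R m n sigma gamma (matrix_of_rows B) sigma_gt0 gamma_gt0.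
rewrite -/P in MI.
have lnP : ln (2^-1 ^+ n * (2^-1 ^+ n * P)) <=
    ln n.+1%:R + n%:R * (S * ln 2) - m%:R * gamma / 2 + K - n%:R * ln 2.
  have P0 : 0 < P by exact: pairwise_exponent_sum_gt0.
  have h0 : 0 < 2^-1 ^+ n :> R by rewrite exprn_gt0.
  have le1 : 2^-1 ^+ n * P <= n.+1%:R * expR (n%:R * (S * ln 2) - m%:R * gamma / 2 + K).
    by rewrite exprVn mulrC ler_pdivrMr ?exprn_gt0// mulrC.
  apply: (@le_trans _ _ (ln (2^-1 ^+ n *
      (n.+1%:R * expR (n%:R * (S * ln 2) - m%:R * gamma / 2 + K))))).
    by rewrite ler_ln ?posrE ?mulr_gt0 ?expR_gt0// ler_pM2l.
  rewrite !lnM ?posrE ?mulr_gt0 ?expR_gt0// expRK lnXn// lnV ?posrE// -mulr_natl.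
  lra.
have capge : ((n%:R * (1 - S - (ln n.+1%:R + K) / (n%:R * ln 2)))%:E <=
    max_sum_capacity m n sigma)%E.
  apply: (@le_trans _ _ (sum_capacity sigma (matrix_of_rows B))); last first.
    by apply: ereal_sup_ubound; exists (matrix_of_rows B) => //; exact: sign_matrix_of_rows.
  apply: le_trans (ereal_sup_ubound _); last first.
    by exists (fun=> bernoulli_prob 2^-1).
  apply: le_trans MI; rewrite lee_fin ler_pdivlMr//.
  have -> : n%:R * (1 - S - (ln n.+1%:R + K) / (n%:R * ln 2)) * ln 2 =
      n%:R * ln 2 - n%:R * (S * ln 2) - ln n.+1%:R - K.
    by field; rewrite !gt_eqF.
  lra.
rewrite /normalized_capacity.
apply: le_trans (lee_wpmul2l _ capge); last by rewrite lee_fin invr_ge0 ltW.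
by rewrite -EFinM lee_fin mulrA mulVf ?mul1r// gt_eqF.
Qed.

End random_sign_matrix.

(** * The limit *)

Lemma ln_natS_le_linear {R : realType} (a C : R) : 0 < a ->
  exists N : nat, forall n, (N <= n)%N -> ln n.+1%:R + C <= a * n%:R.
Proof.
move=> a0.
(* Half of the slope dominates ln (n + 1) up to a constant, and the other half absorbs that constant
   together with C. *)
pose b := a / 2; have b0 : 0 < b by rewrite divr_gt0.
pose D := b - 1 - ln b + C.
exists (Num.truncn (D / b)).+1 => n hn.
have nD : D <= b * n%:R.
  rewrite mulrC -ler_pdivrMr//; apply: (@le_trans _ _ (Num.truncn (D / b)).+1%:R).
    exact/ltW/truncnS_gt.
  by rewrite ler_nat.
have : ln (b * n.+1%:R) <= b * n.+1%:R - 1.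
  have p0 : 0 < b * n.+1%:R by rewrite mulr_gt0 ?ltr0n.
  by rewrite -[X in ln X](subrKC 1); apply: le_ln1Dx; lra.
rewrite lnM ?posrE ?ltr0n// -natr1 mulrDr mulr1 => h.
have -> : a * n%:R = b * n%:R + b * n%:R by rewrite /b; field.
by move: h nD; rewrite /D; lra.
Qed.

Lemma limf_einf_capacity_ge {R : realType} (sigma beta gamma S : R) :
  0 < sigma -> 0 < gamma ->
  (forall t : R, 0 <= t <= 1 ->
    binary_entropy t + (2 * beta)^-1 * (gamma * log2 (expR 1) -
      log2 (1 + gamma / sigma ^+ 2 * (sigma ^+ 2 + 4 * t * beta))) <= S) ->
  ((1 - S)%:E <=
   limf_einf (fun mn : nat * nat => normalized_capacity mn.1 mn.2 sigma)
     (fixed_ratio_oo beta))%E.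
Proof.
move=> sigma0 gamma0 hS; rewrite limf_einfE.
apply/lee_subgt0Pr => e e0.
have ln20 : 0 < ln 2 :> R by rewrite ln_gt0// ltr1n.
pose L := 2 * gamma / (sigma ^+ 2 * (1 + gamma)).
have [N hN] := @ln_natS_le_linear R (e * ln 2) (L * ln (1 + 2 * L * beta)) (mulr_gt0 e0 ln20).
(* A member of the filter on which the finite bound holds with error at most e. If no pair has ratio
   [beta], V is empty and its infimum is +oo. *)
pose V := [set mn : nat * nat | [/\ (Num.truncn (2 * L) < mn.1)%N, (N < mn.2)%N &
  mn.2%:R / mn.1%:R = beta]].
apply: (@le_trans _ _ (ereal_inf
    ((fun mn : nat * nat => normalized_capacity mn.1 mn.2 sigma) @` V))); last first.
  apply: ereal_sup_ubound; exists V => //.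
  exists ([set m | (Num.truncn (2 * L) < m)%N], [set n | (N < n)%N]).
    by split; [exact: nbhs_infty_gt|exact: nbhs_infty_gt].
  by move=> [m n] [/= mL nN] mn_beta.
apply: le_ereal_inf_tmp => _ [[m n] [/= mL nN mn_beta] <-].
have m0 : (0 < m)%N by apply: leq_trans mL.
have n0 : (0 < n)%N by apply: leq_trans nN.
have mL' : 2 * L < m%:R.
  by apply: (lt_le_trans (truncnS_gt _)); rewrite ler_nat.
have := @normalized_capacity_ge R m n sigma beta gamma m0 n0 sigma0 gamma0 mn_beta mL' S hS.
apply: le_trans; rewrite -EFinB lee_fin lerD2l lerN2 ler_pdivrMr ?mulr_gt0 ?ltr0n//.
rewrite (_ : e * (n%:R * ln 2) = e * ln 2 * n%:R); last by ring.
exact: hN (ltnW nN).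
Qed.

Theorem mainTheorem9 (R : realType) (sigma beta : R)
    (sigma_gt0 : 0 < sigma) (beta_gt0 : 0 < beta) :
  (1 - ereal_inf [set ereal_sup
         [set (binary_entropy t + (2 * beta)^-1 *
                (gamma * log2 (expR 1) -
                 log2 (1 + gamma / sigma ^+ 2 *
                           (sigma ^+ 2 + 4 * t * beta))))%:E
         | t in [set t : R | 0 <= t <= 1]%R]
       | gamma in [set gamma : R | 0 < gamma]%R]
   <= limf_einf (fun mn : nat * nat => normalized_capacity mn.1 mn.2 sigma)
        (fixed_ratio_oo beta))%E.
Proof.
set l := limf_einf _ _.
(* With l moved across, there is one bound for each [gamma], and these pass to the infimum. *)
have key (gamma : R) : 0 < gamma -> (1 - l <= ereal_sup
         [set (binary_entropy t + (2 * beta)^-1 *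
                (gamma * log2 (expR 1) -
                 log2 (1 + gamma / sigma ^+ 2 *
                           (sigma ^+ 2 + 4 * t * beta))))%:E
         | t in [set t : R | 0 <= t <= 1]%R])%E.
  move=> gamma0; set B := [set _ | _ in _].
  have ubB t : 0 <= t <= 1 -> ((binary_entropy t + (2 * beta)^-1 *
      (gamma * log2 (expR 1) - log2 (1 + gamma / sigma ^+ 2 *
         (sigma ^+ 2 + 4 * t * beta))))%:E <= ereal_sup B)%E.
    by move=> t01; apply: ereal_sup_ubound; exists t.
  (* An infinite supremum makes the bound trivial, and the value at t = 0 excludes -oo. *)
  case E : (ereal_sup B) ubB => [S||] ubB; last 2 first.
  - exact: leey.
  - by have := ubB 0; rewrite lexx ler01 => /(_ isT).
  have := @limf_einf_capacity_ge R sigma beta gamma S sigma_gt0 gamma0 ubB.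
  rewrite -/l; case: l => [r||] //.
  - by rewrite -EFinB !lee_fin; lra.
  - by rewrite leNye.
have : (1 - l <= ereal_inf [set ereal_sup
         [set (binary_entropy t + (2 * beta)^-1 *
                (gamma * log2 (expR 1) -
                 log2 (1 + gamma / sigma ^+ 2 *
                           (sigma ^+ 2 + 4 * t * beta))))%:E
         | t in [set t : R | 0 <= t <= 1]%R]
       | gamma in [set gamma : R | 0 < gamma]%R])%E.
  by apply: le_ereal_inf_tmp => _ [gamma gamma0 <-]; exact: key.
case: l key => [r||] _; case: (ereal_inf _) => [s||] //=; rewrite ?addeNy ?leey ?leNye//.
by rewrite -!EFinB !lee_fin; lra.
Qed.
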